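(* Let $n$ be a positive multiple of $6$. Then the maximum length of a cycle in an underlying graph with $n$ vertices, the maximum being taken over all configurations of $n$ points, is exactly $n-3$.
   Context: A configuration of $n$ points ($n$ even) is a set of $n$ points in $\mathbb{R}^2$ in general position (no three collinear). A halving line of the configuration is a line through two of the points such that exactly $(n-2)/2$ of the remaining $n-2$ points lie on each side of it. The underlying graph of the configuration is the graph whose vertices are the $n$ points, two vertices being adjacent if and only if the line through the corresponding two points is a halving line. A cycle is a simple cycle (no repeated vertices), not necessarily induced, and its length is its number of vertices. *)

(* Defs.v *)
From HB Require Import structures.
From mathcomp Require Import all_boot all_order all_algebra.
From mathcomp Require Import reals.

Set Implicit Arguments.
Unset Strict Implicit.
Unset Printing Implicit Defensive.

Import Order.TTheory GRing.Theory Num.Theory.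
Local Open Scope ring_scope.

(* The determinant of (b - a, c - a). For a != b, the line through a and b is
   the zero set of [orient a b], and its two open sides are the sets where
   [orient a b] is positive, resp. negative. *)
Definition orient (R : realType) (a b c : R * R) : R :=
  (b.1 - a.1) * (c.2 - a.2) - (b.2 - a.2) * (c.1 - a.1).

Definition collinear (R : realType) (a b c : R * R) : Prop :=
  orient a b c = 0.

Definition configuration (R : realType) (n : nat) (p : 'I_n -> R * R) : Prop :=
  injective p /\
  forall i j k : 'I_n, i != j -> i != k -> j != k ->
    ~ collinear (p i) (p j) (p k).

(* [n] is meant to be even; [p i] and [p j] themselves lie on the line, so
   they are counted on neither side. *)
Definition halving (R : realType) (n : nat) (p : 'I_n -> R * R)
    (i j : 'I_n) : bool :=
  (#|[set k : 'I_n | (0 < orient (p i) (p j) (p k))%R]| == (n - 2)./2)%N &&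
  (#|[set k : 'I_n | (orient (p i) (p j) (p k) < 0)%R]| == (n - 2)./2)%N.

Definition underlying_graph (R : realType) (n : nat) (p : 'I_n -> R * R) :
    rel 'I_n :=
  fun i j => (i != j) && halving p i j.

(* The size condition is needed because [ucycle] also accepts the empty
   sequence and, for a symmetric relation, a single edge traversed back and
   forth. *)
Definition graph_cycle (T : finType) (e : rel T) (s : seq T) : Prop :=
  (2 < size s)%N /\ ucycle e s.

(* m is the length of a cycle in the underlying graph of some configuration
   of n points. *)
Definition cycle_length (R : realType) (n m : nat) : Prop :=
  exists p : 'I_n -> R * R, configuration p /\
  exists s : seq 'I_n, graph_cycle (underlying_graph p) s /\ size s = m.

Definition is_maximum (A : nat -> Prop) (M : nat) : Prop :=
  A M /\ forall m : nat, A m -> (m <= M)%N.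

(* Main.v *)
Require Import Defs.
From mathcomp Require Import all_boot all_order all_algebra.
From mathcomp Require Import reals.
From mathcomp Require Import zify ring lra.

(** Upper bound.  If all the points lie on one side of a line through the
    points [v] and [w], then [v] has at most one neighbour in the underlying
    graph: seen from [v] the other points are linearly ordered by angle, and
    only the median one can lie on a halving line ([halving_extreme_unique]).
    Every configuration has three such points, namely a point [v] farthest
    from the origin and the first and the last point in the angular order
    around [v] ([three_extreme_points]).  A vertex of a cycle has two
    neighbours, so the cycle misses these three points.

    Lower bound.  Let [n = 6k].  Three lines, permuted by a linear map of
    order 3, bound a triangle with vertices X, Y, Z.  Each line carries an arm
    of [2k] points: an arm starts near one vertex of the triangle with [k - 1]
    inner points, follows a side of the triangle, and continues beyond the
    next vertex with [k + 1] outer points, so that the three arms form a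
    pinwheel.  The line of an arm then separates the inner from the outer
    points of the next arm and has the whole previous arm on the same side as
    these inner points.  Bend each arm very slightly, so that it bulges towards
    that side.  The line through two consecutive points of an arm has on one
    side the other [2k - 2] points of the arm and the [k + 1] outer points of
    the next arm, and on the other side the [k - 1] inner points of the next
    arm and the [2k] points of the previous one: [3k - 1] on each side.  Thus
    every arm is a path of the underlying graph ([halving_along_arm]).
    Moreover the innermost point of an arm is joined to the last but one point
    of the next arm ([halving_across_arms]).  Following the arms inwards from
    their last but one points, one after the other, gives a cycle which misses
    only the three outermost points. *)

Set Implicit Arguments.
Unset Strict Implicit.
Unset Printing Implicit Defensive.

Import Order.TTheory GRing.Theory Num.Theory.
Local Open Scope ring_scope.

(** * Orientation of triples of points *)

Lemma orient_cycle (R : realType) (a b c : R * R) : orient b c a = orient a b c.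
Proof. by rewrite /orient; ring. Qed.

Lemma orient_swap (R : realType) (a b c : R * R) : orient b a c = - orient a b c.
Proof. by rewrite /orient; ring. Qed.

Lemma orient_swapr (R : realType) (a b c : R * R) : orient a c b = - orient a b c.
Proof. by rewrite /orient; ring. Qed.

Lemma orient_xxy (R : realType) (a b : R * R) : orient a a b = 0.
Proof. by rewrite /orient; ring. Qed.

Lemma orient_xyx (R : realType) (a b : R * R) : orient a b a = 0.
Proof. by rewrite /orient; ring. Qed.

Lemma orient_xyy (R : realType) (a b : R * R) : orient a b b = 0.
Proof. by rewrite /orient; ring. Qed.

(** The Grassmann-Pluecker relation for the vectors from [v]; it is what makes
    the angular order around an extreme point transitive. *)
Lemma orient_plucker (R : realType) (v w a b c : R * R) :
  orient v w b * orient v a c =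
  orient v w a * orient v b c + orient v w c * orient v a b.
Proof. by rewrite /orient; ring. Qed.

Lemma configuration_orient_neq0 (R : realType) n (p : 'I_n -> R * R) i j k :
  configuration p -> i != j -> i != k -> j != k -> orient (p i) (p j) (p k) != 0.
Proof. by move=> [_ H] ij ik jk; apply/eqP; apply: H. Qed.

(** * At least three points lie on no cycle *)

Lemma halving_sym (R : realType) n (p : 'I_n -> R * R) (i j : 'I_n) :
  halving p i j = halving p j i.
Proof.
rewrite /halving andbC; congr (_ && _); congr (_ == _); apply: eq_card => k;
  by rewrite !inE [orient (p j) _ _]orient_swap ?oppr_gt0 ?oppr_lt0.
Qed.

(** All points lie on one side of the line through [p v] and [p w].  The product
    avoids choosing which side, and makes the notion symmetric in [v] and [w]. *)
Definition supporting (R : realType) n (p : 'I_n -> R * R) (v w : 'I_n) : Prop :=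
  v != w /\ forall k l, 0 <= orient (p v) (p w) (p k) * orient (p v) (p w) (p l).

Lemma supporting_sym (R : realType) n (p : 'I_n -> R * R) v w :
  supporting p v w -> supporting p w v.
Proof.
by move=> [vw H]; split=> [|k l]; rewrite 1?eq_sym// !(orient_swap (p v)) mulrNN.
Qed.

(** The points other than [v] lie in a half-plane bounded by a line through [v],
    so turning around [v] counterclockwise is a strict order on them. *)
Lemma orient_trans (R : realType) n (p : 'I_n -> R * R) (v w a b c : 'I_n) :
  configuration p -> supporting p v w -> v != a -> v != c ->
  0 < orient (p v) (p a) (p b) -> 0 < orient (p v) (p b) (p c) ->
  0 < orient (p v) (p a) (p c).
Proof.
move=> cp [vw sv] va vc ab bc.
have ac : a != c.
  apply/eqP => E; move: bc.
  by rewrite -E orient_swapr oppr_gt0 ltNge (ltW ab).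
have vb : v != b by apply: contraTneq ab => <-; rewrite orient_xyx ltxx.
rewrite lt_neqAle eq_sym configuration_orient_neq0//=.
have [bw|bw] := eqVneq b w.
  have := sv a c; rewrite -bw.
  have -> : orient (p v) (p b) (p a) = - orient (p v) (p a) (p b).
    exact: orient_swapr.
  nra.
have wb : orient (p v) (p w) (p b) != 0.
  by rewrite configuration_orient_neq0// eq_sym.
have wb2 : 0 < orient (p v) (p w) (p b) ^+ 2 by rewrite exprn_even_gt0.
rewrite -(pmulr_rge0 _ wb2) expr2 -mulrA orient_plucker mulrDr !mulrA.
by rewrite addr_ge0// mulr_ge0 ?sv// ltW.
Qed.

(** If [b] comes after [a] in the angular order around [v], the points after [b]
    form a proper subset of those after [a], so [va] and [vb] cannot both have
    the same number of points on their left. *)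
Lemma halving_extreme_unique (R : realType) n (p : 'I_n -> R * R) (v w a b : 'I_n) :
  configuration p -> supporting p v w -> v != a -> v != b ->
  halving p v a -> halving p v b -> a = b.
Proof.
move=> cp sv.
have key (c d : 'I_n) : v != c -> halving p v c -> halving p v d ->
    0 < orient (p v) (p c) (p d) -> false.
  move=> vc /andP[/eqP hc _] /andP[/eqP hd _] cd.
  suff : (#|[set k | (0 < orient (p v) (p d) (p k))%R]| <
          #|[set k | (0 < orient (p v) (p c) (p k))%R]|)%N by rewrite hc hd ltnn.
  apply: proper_card; apply/properP; split.
    apply/subsetP => k; rewrite !inE => dk.
    apply: (orient_trans cp sv _ _ cd dk) => //.
    by apply: contraTneq dk => <-; rewrite orient_xyx ltxx.
  by exists d; rewrite !inE ?orient_xyy ?ltxx.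
move=> va vb ha hb; apply/eqP; case: eqVneq => // ab.
have /lt_total/orP[] := configuration_orient_neq0 cp va vb ab.
  by rewrite -oppr_gt0 -orient_swapr => h; rewrite (key b a).
by move=> h; rewrite (key a b).
Qed.

Lemma farthest_exists (R : realType) n (p : 'I_n -> R * R) : (0 < n)%N ->
  exists v, forall k, (p k).1 ^+ 2 + (p k).2 ^+ 2 <= (p v).1 ^+ 2 + (p v).2 ^+ 2.
Proof.
case: n p => // n p _.
case: (@arg_maxP _ _ _ ord0 predT (fun k => (p k).1 ^+ 2 + (p k).2 ^+ 2)%R) => // v _ H.
by exists v => k; apply: H.
Qed.

(** A farthest point [v] from the origin has all the other points strictly
    inside the half-plane bounded by the tangent at [v] to the circle through
    [v].  The slope [tau] of a point seen from [v], measured from the normal of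
    this tangent, therefore describes the angular order around [v], and the
    points of extreme slope span supporting lines with [v]. *)
Lemma three_extreme_points (R : realType) n (p : 'I_n -> R * R) :
  configuration p -> (2 < n)%N ->
  exists v, exists a, exists b,
    [/\ supporting p v a, supporting p v b & a != b].
Proof.
move=> cp n2.
have [v vmax] := farthest_exists p (ltnW (ltnW n2)).
pose N := (p v).1 ^+ 2 + (p v).2 ^+ 2.
(* Up to the factor [sqrt N], [phi k] is the distance of [p k] from the tangent
   at [p v], and [c k] is its coordinate along this tangent. *)
pose phi k := N - ((p v).1 * (p k).1 + (p v).2 * (p k).2).
pose c k := (p v).1 * ((p k).2 - (p v).2) - (p v).2 * ((p k).1 - (p v).1).
have phi_gt0 k : k != v -> 0 < phi k.
  move=> kv; have := vmax k.
  have : 0 < ((p v).1 - (p k).1) ^+ 2 + ((p v).2 - (p k).2) ^+ 2.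
    rewrite lt_neqAle addr_ge0 ?sqr_ge0// andbT eq_sym paddr_eq0 ?sqr_ge0//.
    rewrite !sqrf_eq0 !subr_eq0; apply: contra kv => /andP[/eqP h1 /eqP h2].
    apply/eqP; case: cp => inj _; apply: inj.
    by rewrite [LHS]surjective_pairing [RHS]surjective_pairing h1 h2.
  by rewrite /phi /N => ? ?; nra.
have cross k l : N * orient (p v) (p k) (p l) = c k * phi l - phi k * c l.
  by rewrite /c /phi /N /orient; ring.
have [k0 k0v] : exists k, k != v.
  have : (0 < #|[set~ v]|)%N by rewrite cardsC1 card_ord; lia.
  by case/card_gt0P => k; rewrite !inE => kv; exists k.
have N_gt0 : 0 < N.
  have N_ge0 : 0 <= N by rewrite addr_ge0 ?sqr_ge0.
  have phi0 := phi_gt0 _ k0v.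
  rewrite lt_neqAle N_ge0 andbT eq_sym; apply: contraTneq phi0 => N0.
  have /andP[/eqP h1 /eqP h2] : ((p v).1 == 0) && ((p v).2 == 0).
    by move/eqP: N0; rewrite paddr_eq0 ?sqr_ge0// !sqrf_eq0.
  by rewrite /phi N0 h1 h2 !mul0r addr0 subr0 ltxx.
pose tau k := c k / phi k.
have orientE k l : k != v -> l != v ->
    N * orient (p v) (p k) (p l) = phi k * phi l * (tau k - tau l).
  move=> kv lv; rewrite cross /tau.
  have := phi_gt0 _ kv; have := phi_gt0 _ lv.
  move: (phi k) (phi l) (c k) (c l) => x y d e y0 x0.
  by field; rewrite !gt_eqF.
case: (@arg_minP _ _ _ k0 (fun k => k != v) tau k0v) => a av amin.
case: (@arg_maxP _ _ _ k0 (fun k => k != v) tau k0v) => b bv bmax.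
have sup d : d != v -> (forall k, k != v -> 0 <= tau d - tau k) \/
    (forall k, k != v -> tau d - tau k <= 0) -> supporting p v d.
  move=> dv H; split; first by rewrite eq_sym.
  move=> k l.
  have [->|kv] := eqVneq k v; first by rewrite orient_xyx mul0r.
  have [->|lv] := eqVneq l v; first by rewrite orient_xyx mulr0.
  rewrite -(pmulr_rge0 _ N_gt0) -(pmulr_rge0 _ N_gt0).
  rewrite mulrA mulrACA !orientE// mulrACA mulr_ge0//.
    by rewrite !mulr_ge0// ltW// phi_gt0.
  case: H => H; first by rewrite mulr_ge0 ?H.
  by rewrite -mulrNN mulr_ge0 // oppr_ge0 H.
exists v, a, b; split.
- by apply: sup => //; right => k kv; rewrite subr_le0; apply: amin.
- by apply: sup => //; left => k kv; rewrite subr_ge0; apply: bmax.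
apply/eqP => ab.
have [l la] : exists l, (l != v) && (l != a).
  have : (0 < #|~: [set v; a]|)%N.
    by rewrite cardsCs setCK card_ord cards2 eq_sym av; lia.
  by case/card_gt0P => l; rewrite !inE negb_or => h; exists l.
case/andP: la => lv la.
have := orientE a l av lv.
rewrite (_ : tau a = tau l); last first.
  by apply/le_anti/andP; split; [exact: amin | rewrite ab; exact: bmax].
move/eqP; rewrite subrr mulr0 mulf_eq0 gt_eqF//=.
by apply/negP; rewrite configuration_orient_neq0// eq_sym.
Qed.

(** The two neighbours are the successor and the predecessor on the cycle; they
    differ because the cycle has at least three vertices. *)
Lemma cycle_two_neighbours (T : eqType) (e : rel T) (s : seq T) (v : T) :
  (2 < size s)%N -> ucycle e s -> v \in s ->
  exists a b, [/\ a != b, e v a & e b v].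
Proof.
move=> s2 /andP[cs us] vs.
have [i s' E] := rot_to vs.
have : cycle e (v :: s') by rewrite -E rot_cycle.
have : uniq (v :: s') by rewrite -E rot_uniq.
have : (2 < size (v :: s'))%N by rewrite -E size_rot.
case: s' {E} => [|a [|b t]] //= _ /and3P[_ + _] /andP[va].
rewrite rcons_path -/(last b t) => at_ /andP[_] /andP[_ lv].
exists a, (last b t); split => //.
by apply: contraNneq at_ => ->; rewrite mem_last.
Qed.

Lemma cycle_length_le (R : realType) n m :
  (2 < n)%N -> cycle_length R n m -> (m <= n - 3)%N.
Proof.
move=> n2 [p [cp [s [[s2 cs] <-]]]].
have [v [a [b [sva svb ab]]]] := three_extreme_points cp n2.
have out x y : supporting p x y -> x \notin s.
  move=> sxy; apply/negP => /(cycle_two_neighbours s2 cs)[c [d [cd]]].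
  move=> /andP[xc hc] /andP[dx hd]; case/eqP: cd.
  by apply: halving_extreme_unique cp sxy _ _ _ _; rewrite // 1?eq_sym// halving_sym.
have us : uniq s by case/andP: cs.
have vab : #|[set v; a; b]| = 3.
  rewrite -setUA cardsU1 !inE cards2 ab.
  by case: sva svb => va _ [vb _]; rewrite (negbTE va) (negbTE vb).
have <- : #|~: [set v; a; b]| = (n - 3)%N by rewrite cardsCs setCK card_ord vab.
rewrite -(card_uniqP us); apply/subset_leq_card/subsetP => x.
rewrite !inE; apply: contraTN => /orP[/orP[]|] /eqP ->.
- exact: out sva.
- exact: out (supporting_sym sva).
- exact: out (supporting_sym svb).
Qed.

(** * Orientations in the pinwheel of three arms *)

(** A linear map of order 3 and determinant 1.  It plays the role of the
    rotation by a third of a turn, with integer coefficients. *)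
Definition turn (R : realType) (q : R * R) : R * R := (- q.2, q.1 - q.2).

Lemma turnK (R : realType) (q : R * R) : turn (turn (turn q)) = q.
Proof. by case: q => x y; rewrite /turn /=; congr pair; ring. Qed.

Lemma orient_turn (R : realType) (a b c : R * R) :
  orient (turn a) (turn b) (turn c) = orient a b c.
Proof. by rewrite /orient /turn /=; ring. Qed.

(** Up to curvature, arm 0 lies on the line [y = 1], and it meets the lines of
    the arms 1 and 2 at the abscissas -1 and 2, while arm 1 meets it at the
    parameter 2.  The number [s] of the arm only matters modulo 3, which allows
    to speak of the next arm [s.+1] and of the previous arm [s.+2]. *)
Definition arm (R : realType) (s : nat) (x : R) : R * R :=
  iter s (@turn R) (x, 1 + x ^+ 2 / 1000%:R).

Lemma armS (R : realType) s (x : R) : arm s.+1 x = turn (arm s x).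
Proof. by []. Qed.

Lemma arm3 (R : realType) s (x : R) : arm s.+3 x = arm s x.
Proof. by rewrite !armS turnK. Qed.

Lemma arm_mod3 (R : realType) s (x : R) : arm (s %% 3) x = arm s x.
Proof.
rewrite [in RHS](divn_eq s 3).
by elim: (s %/ 3)%N => [|q IH] //; rewrite mulSn -addnA arm3.
Qed.

(** Inner points lie on the side of the triangle, near its vertex of parameter
    -1.  The distance 1/10 to this vertex dominates the effect of the curvature
    1/1000 of the arms. *)
Definition inner (R : realType) (x : R) := (- (9 / 10) <= x <= - (8 / 10))%R.
(** Outer points lie beyond the vertex of parameter 2. *)
Definition outer (R : realType) (x : R) := (3 <= x <= 31 / 10)%R.

(** Three points of a parabola: a Vandermonde determinant. *)
Lemma orient_same_arm (R : realType) s (x y z : R) :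
  orient (arm s x) (arm s y) (arm s z) =
  (y - x) * (z - x) * (z - y) / 1000%:R.
Proof.
elim: s => [|s IH]; last by rewrite !armS orient_turn.
by rewrite /orient /arm /=; field.
Qed.

Lemma orient_same_arm_le0 (R : realType) s (x y z : R) :
  x < y -> 0 <= (z - y) * (z - x) -> orient (arm s y) (arm s x) (arm s z) <= 0.
Proof.
move=> xy h; rewrite orient_same_arm.
have -> : (x - y) * (z - y) * (z - x) / 1000%:R =
  - ((y - x) * ((z - y) * (z - x)) / 1000%:R) by field.
by rewrite oppr_le0 divr_ge0 ?ler0n// mulr_ge0// subr_ge0 ltW.
Qed.

Lemma sqr_bound (R : realType) (x : R) :
  inner x || outer x -> 0 <= x ^+ 2 / 1000%:R <= 1 / 100.
Proof. by case/orP => /andP[? ?]; nra. Qed.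

Lemma in_bound (R : realType) (x : R) :
  inner x || outer x -> - (9 / 10) <= x <= 31 / 10.
Proof. by case/orP => /andP[? ?]; lra. Qed.

(** The line of an arm crosses the next arm between its inner and its outer
    points.  The factor [y - x] is common to both terms of the determinant; once
    it is removed, the slope of the chord is too small to change the sign. *)
Lemma orient_next_outer (R : realType) s (x y z : R) :
  inner x || outer x -> inner y || outer y -> x < y -> outer z ->
  0 < orient (arm s x) (arm s y) (arm s.+1 z).
Proof.
elim: s => [|s IH] Ix Iy xy Oz; last by rewrite !armS orient_turn; apply: IH.
have := sqr_bound Ix; have := @sqr_bound _ z; rewrite Oz orbT => /(_ isT).
rewrite /orient /arm /turn /=.
set ez := z ^+ 2 / _; set ex := x ^+ 2 / _ => /andP[z0 z1] /andP[x0 x1].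
have -> : 1 + y ^+ 2 / 1000%:R - (1 + ex) = (y - x) * ((y + x) / 1000%:R).
  by rewrite /ex; field.
have /andP[? ?] := in_bound Ix; have /andP[? ?] := in_bound Iy.
case/andP: Oz => ? ?.
rewrite -mulrA -mulrBr mulr_gt0 ?subr_gt0//.
have : (y + x) * (- (1 + ez) - x) <= 10 by nra.
lra.
Qed.

Lemma orient_next_inner (R : realType) s (x y z : R) :
  inner x || outer x -> inner y || outer y -> x < y -> inner z ->
  orient (arm s x) (arm s y) (arm s.+1 z) < 0.
Proof.
elim: s => [|s IH] Ix Iy xy Oz; last by rewrite !armS orient_turn; apply: IH.
have := sqr_bound Ix; have := @sqr_bound _ z; rewrite Oz => /(_ isT).
rewrite /orient /arm /turn /=.
set ez := z ^+ 2 / _; set ex := x ^+ 2 / _ => /andP[z0 z1] /andP[x0 x1].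
have -> : 1 + y ^+ 2 / 1000%:R - (1 + ex) = (y - x) * ((y + x) / 1000%:R).
  by rewrite /ex; field.
have /andP[? ?] := in_bound Ix; have /andP[? ?] := in_bound Iy.
case/andP: Oz => ? ?.
rewrite -mulrA -mulrBr pmulr_rlt0 ?subr_gt0//.
have : - 40 <= (y + x) * (- (1 + ez) - x) by nra.
lra.
Qed.

(** The previous arm stays on one side.  Its inner points come closest to the
    line, at a distance of about 1/10, which still exceeds the deviation of
    the chord. *)
Lemma orient_prev (R : realType) s (x y z : R) :
  inner x || outer x -> inner y || outer y -> x < y -> inner z || outer z ->
  orient (arm s x) (arm s y) (arm s.+2 z) < 0.
Proof.
elim: s => [|s IH] Ix Iy xy Oz; last by rewrite !armS orient_turn; apply: IH.
have := sqr_bound Ix; have := sqr_bound Oz.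
rewrite /orient /arm /turn /=.
set ez := z ^+ 2 / _; set ex := x ^+ 2 / _ => /andP[z0 z1] /andP[x0 x1].
have -> : 1 + y ^+ 2 / 1000%:R - (1 + ex) = (y - x) * ((y + x) / 1000%:R).
  by rewrite /ex; field.
have /andP[? ?] := in_bound Ix; have /andP[? ?] := in_bound Iy.
have /andP[? ?] := in_bound Oz.
rewrite -mulrA -mulrBr pmulr_rlt0 ?subr_gt0//.
have : - 50 <= (y + x) * (- (z - (1 + ez)) - x) by nra.
lra.
Qed.

(** Triples with one point on each arm.  Up to the small curvature terms, inner
    points can be replaced by vertices of the triangle; the orientation turns
    out to be negative exactly when one of the three points is outer and two
    are inner. *)
Lemma orient_three_arms (R : realType) s (x y z : R) :
  orient (arm s x) (arm s.+1 y) (arm s.+2 z) =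
  (y - (1 + y ^+ 2 / 1000%:R) - (1 + x ^+ 2 / 1000%:R)) * (x + z - (1 + z ^+ 2 / 1000%:R))
  + (x + (1 + y ^+ 2 / 1000%:R)) * (z + (1 + x ^+ 2 / 1000%:R)).
Proof.
elim: s => [|s IH]; last by rewrite !armS orient_turn.
by rewrite /orient /arm /=; ring.
Qed.

Lemma orient_arms_inner_outer (R : realType) s (x y z : R) :
  inner x -> outer y -> inner z ->
  orient (arm s x) (arm s.+1 y) (arm s.+2 z) < 0.
Proof.
move=> Ix Oy Iz; rewrite orient_three_arms.
have := @sqr_bound _ x; rewrite Ix => /(_ isT).
have := @sqr_bound _ y; rewrite Oy orbT => /(_ isT).
have := @sqr_bound _ z; rewrite Iz => /(_ isT).
move: (z ^+ 2 / _) (y ^+ 2 / _) (x ^+ 2 / _) => ez ey ex /andP[? ?] /andP[? ?] /andP[? ?].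
move: Ix Oy Iz => /andP[? ?] /andP[? ?] /andP[? ?].
set A := y - _ - _; set B := x + z - _; set C := x + _; set D := z + _.
have AB : A * B <= - 2.
  have : 9 / 10 <= A <= 2 by rewrite /A; apply/andP; split; lra.
  have : B <= - (26 / 10) by rewrite /B; lra.
  by move=> ? /andP[? ?]; nra.
have CD : C * D <= 1.
  have : 0 <= C <= 1 by rewrite /C; apply/andP; split; lra.
  have : 0 <= D <= 1 by rewrite /D; apply/andP; split; lra.
  by move=> /andP[? ?] /andP[? ?]; nra.
lra.
Qed.

Lemma orient_arms_outer2 (R : realType) s (x y z : R) :
  inner x || outer x -> outer y -> outer z ->
  0 < orient (arm s x) (arm s.+1 y) (arm s.+2 z).
Proof.
move=> IOx Oy Oz; rewrite orient_three_arms.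
have := sqr_bound IOx.
have := @sqr_bound _ y; rewrite Oy orbT => /(_ isT).
have := @sqr_bound _ z; rewrite Oz orbT => /(_ isT).
move: (z ^+ 2 / _) (y ^+ 2 / _) (x ^+ 2 / _) => ez ey ex /andP[? ?] /andP[? ?] /andP[? ?].
have /andP[? ?] := in_bound IOx.
move: Oy Oz => /andP[? ?] /andP[? ?].
rewrite addr_gt0 // mulr_gt0 //; lra.
Qed.

Lemma orient_arms_inner3 (R : realType) s (x y z : R) :
  inner x -> inner y -> inner z ->
  0 < orient (arm s x) (arm s.+1 y) (arm s.+2 z).
Proof.
move=> Ix Iy Iz; rewrite orient_three_arms.
have := @sqr_bound _ x; rewrite Ix => /(_ isT).
have := @sqr_bound _ y; rewrite Iy => /(_ isT).
have := @sqr_bound _ z; rewrite Iz => /(_ isT).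
move: (z ^+ 2 / _) (y ^+ 2 / _) (x ^+ 2 / _) => ez ey ex /andP[? ?] /andP[? ?] /andP[? ?].
move: Ix Iy Iz => /andP[? ?] /andP[? ?] /andP[? ?].
rewrite addr_gt0 //; last by rewrite mulr_gt0 //; lra.
by rewrite -mulrNN mulr_gt0 //; lra.
Qed.

(** The remaining combinations of inner and outer points reduce to the previous
    ones by a cyclic permutation of the arms. *)
Lemma orient_arms_neq0 (R : realType) s (x y z : R) :
  inner x || outer x -> inner y || outer y -> inner z || outer z ->
  orient (arm s x) (arm s.+1 y) (arm s.+2 z) != 0.
Proof.
have rotE t (a b c : R) : orient (arm t a) (arm t.+1 b) (arm t.+2 c) =
    orient (arm t.+1 b) (arm t.+2 c) (arm t.+3 a).
  by rewrite arm3; apply/esym/orient_cycle.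
have neg t (a b c : R) : inner a -> outer b -> inner c ->
    orient (arm t a) (arm t.+1 b) (arm t.+2 c) != 0.
  by move=> Ia Ob Ic; rewrite lt_eqF// orient_arms_inner_outer.
have pos t (a b c : R) : inner a || outer a -> outer b -> outer c ->
    orient (arm t a) (arm t.+1 b) (arm t.+2 c) != 0.
  by move=> Ia Ob Oc; rewrite gt_eqF// orient_arms_outer2.
move=> IOx IOy IOz.
case/orP: (IOx) (IOy) (IOz) => [Ix|Ox] /orP[Iy|Oy] /orP[Iz|Oz].
- by rewrite gt_eqF// orient_arms_inner3.
- by rewrite rotE neg.
- by rewrite neg.
- by rewrite pos.
- by rewrite rotE rotE neg.
- by rewrite rotE pos.
- by rewrite rotE rotE pos.
- by rewrite pos.
Qed.

(** * The pinwheel configuration *)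

(** The ranks below [k.-1] are inner, the [k + 1] ranks from [k.-1] to [2k - 1]
    are outer; the second term stays below 1/10 and separates the points. *)
Definition abscissa (R : realType) (k r : nat) : R :=
  (if (r < k.-1)%N then - (9 / 10) else 3) + r%:R / (20 * k)%:R.

Lemma abscissa_shift (R : realType) k r : (r < 2 * k)%N ->
  0 <= (r%:R / (20 * k)%:R : R) <= 1 / 10.
Proof.
move=> rk; have k0 : 0 < (20 * k)%:R :> R by rewrite ltr0n; lia.
rewrite divr_ge0 ?ler0n//= ler_pdivrMr// mulrC mulrA mulr1 ler_pdivlMr//.
by rewrite -natrM ler_nat; lia.
Qed.

Lemma abscissa_inner (R : realType) k r :
  (r < 2 * k)%N -> (r < k.-1)%N -> inner (abscissa R k r).
Proof.
move=> /(abscissa_shift R) /andP[? ?] rk; rewrite /inner /abscissa rk.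
by apply/andP; split; lra.
Qed.

Lemma abscissa_outer (R : realType) k r :
  (r < 2 * k)%N -> (k.-1 <= r)%N -> outer (abscissa R k r).
Proof.
move=> /(abscissa_shift R) /andP[? ?] rk; rewrite /outer /abscissa ltnNge rk.
by apply/andP; split; lra.
Qed.

Lemma abscissa_bound (R : realType) k r : (r < 2 * k)%N ->
  inner (abscissa R k r) || outer (abscissa R k r).
Proof.
move=> rk; have [h|h] := ltnP r k.-1; first by rewrite abscissa_inner.
by rewrite abscissa_outer ?orbT.
Qed.

Lemma abscissa_lt (R : realType) k r r' :
  (r < r' < 2 * k)%N -> abscissa R k r < abscissa R k r'.
Proof.
move=> /andP[rr rk]; apply: ler_ltD.
  by case: ltnP => h; case: ltnP => h'; (lra || lia).
by rewrite ltr_pM2r ?invr_gt0 ?ltr_nat ?ltr0n//; lia.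
Qed.

Lemma abscissa_le (R : realType) k r r' :
  (r <= r' < 2 * k)%N -> abscissa R k r <= abscissa R k r'.
Proof.
case: (ltngtP r r') => //= [h rk|-> _]; last exact: lexx.
by apply/ltW/abscissa_lt; rewrite h.
Qed.

Lemma abscissa_inj (R : realType) k r r' : (r < 2 * k)%N -> (r' < 2 * k)%N ->
  r != r' -> abscissa R k r != abscissa R k r'.
Proof.
move=> rk rk'; rewrite neq_ltn => /orP[] h; first by rewrite lt_eqF// abscissa_lt ?h.
by rewrite gt_eqF// abscissa_lt ?h.
Qed.

Lemma orient_two_arms_neq0 (R : realType) k s t a b c :
  (a < 2 * k)%N -> (b < 2 * k)%N -> (c < 2 * k)%N -> a != b -> (s != t %[mod 3])%N ->
  orient (arm s (abscissa R k a)) (arm s (abscissa R k b))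
    (arm t (abscissa R k c)) != 0.
Proof.
move=> ak bk ck ab st.
wlog {ab} ab : a b ak bk / (a < b)%N.
  case: (ltngtP a b) ab => // h _ H; first exact: H.
  by rewrite orient_swap oppr_eq0; apply: H.
have xab : abscissa R k a < abscissa R k b by rewrite abscissa_lt ?ab.
have [[Ia Ib] Ic] := (abscissa_bound R ak, abscissa_bound R bk, abscissa_bound R ck).
have [E|E] : (t %% 3 = s.+1 %% 3 \/ t %% 3 = s.+2 %% 3)%N by lia.
  rewrite -[arm t _]arm_mod3 E arm_mod3.
  case/orP: Ic => Ic; first by rewrite lt_eqF// orient_next_inner.
  by rewrite gt_eqF// orient_next_outer.
by rewrite -[arm t _]arm_mod3 E arm_mod3 lt_eqF// orient_prev.
Qed.

Lemma orient_arms_index_neq0 (R : realType) k s1 s2 s3 a b c :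
  (a < 2 * k)%N -> (b < 2 * k)%N -> (c < 2 * k)%N ->
  (s1 = s2 %[mod 3] -> a != b)%N -> (s1 = s3 %[mod 3] -> a != c)%N ->
  (s2 = s3 %[mod 3] -> b != c)%N ->
  orient (arm s1 (abscissa R k a)) (arm s2 (abscissa R k b))
    (arm s3 (abscissa R k c)) != 0.
Proof.
move=> ak bk ck.
have [[Ia Ib] Ic] := (abscissa_bound R ak, abscissa_bound R bk, abscissa_bound R ck).
have [E12|N12] := eqVneq (s1 %% 3)%N (s2 %% 3)%N.
  move=> /(_ E12) ab.
  rewrite -[arm s2 _]arm_mod3 -E12 arm_mod3.
  have [E13|N13] := eqVneq (s1 %% 3)%N (s3 %% 3)%N; last first.
    by move=> _ _; rewrite orient_two_arms_neq0.
  rewrite E13 => /(_ erefl) ac /(_ erefl) bc.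
  rewrite -[arm s3 _]arm_mod3 -E13 arm_mod3 orient_same_arm.
  by rewrite !mulf_neq0 ?invr_eq0 ?pnatr_eq0// subr_eq0 eq_sym abscissa_inj.
move=> _.
have [E13|N13] := eqVneq (s1 %% 3)%N (s3 %% 3)%N.
  move=> /(_ E13) ac _.
  rewrite -[arm s3 _]arm_mod3 -E13 arm_mod3 orient_swapr oppr_eq0.
  by rewrite orient_two_arms_neq0.
move=> _.
have [E23|N23] := eqVneq (s2 %% 3)%N (s3 %% 3)%N.
  move=> /(_ E23) bc.
  rewrite -[arm s3 _]arm_mod3 -E23 arm_mod3 -orient_cycle.
  by rewrite orient_two_arms_neq0// eq_sym.
move=> _.
have [[E2 E3]|[E2 E3]] : (s2 %% 3 = s1.+1 %% 3 /\ s3 %% 3 = s1.+2 %% 3 \/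
    s2 %% 3 = s1.+2 %% 3 /\ s3 %% 3 = s1.+1 %% 3)%N by lia.
  rewrite -[arm s2 _]arm_mod3 E2 arm_mod3 -[arm s3 _]arm_mod3 E3 arm_mod3.
  exact: orient_arms_neq0.
rewrite -[arm s2 _]arm_mod3 E2 arm_mod3 -[arm s3 _]arm_mod3 E3 arm_mod3.
by rewrite orient_swapr oppr_eq0 orient_arms_neq0.
Qed.

(** The point of index [i] has rank [i %/ 3] on the arm [i %% 3]; as [arm] is
    periodic, the reduction modulo 3 can be left out. *)
Definition pinwheel (R : realType) (n : nat) (i : 'I_n) : R * R :=
  arm i (abscissa R (n %/ 6) (i %/ 3)).

Lemma pinwheel_configuration (R : realType) n :
  (0 < n)%N -> (6 %| n)%N -> configuration (@pinwheel R n).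
Proof.
move=> n0 n6.
have rk (i : 'I_n) : (i %/ 3 < 2 * (n %/ 6))%N by have := ltn_ord i; lia.
have nc (i j l : 'I_n) : i != j -> i != l -> j != l ->
    orient (pinwheel R i) (pinwheel R j) (pinwheel R l) != 0.
  rewrite -!(inj_eq val_inj) /= => ij il jl.
  by apply: orient_arms_index_neq0 => //; lia.
(* Injectivity follows from noncollinearity, with any third point. *)
split; last by move=> i j l ij il jl /eqP; apply/negP/nc.
move=> i j E; apply/eqP; case: eqVneq => // ij.
have /card_gt0P[l] : (0 < #|~: [set i; j]|)%N.
  by rewrite cardsCs setCK card_ord cards2 ij; lia.
rewrite !inE negb_or => /andP[li lj].
have := nc i j l ij; rewrite E orient_xxy eqxx => H.
by have := H; rewrite ![_ == l]eq_sym => /(_ li lj).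
Qed.

(** * Counting the points on one side of a line *)

(** In general position the two sides of the line share the other [n - 2]
    points, so it suffices to count one of them. *)
Lemma halving_one_side (R : realType) n (p : 'I_n -> R * R) (i j : 'I_n) :
  configuration p -> i != j ->
  (2 * #|[set k | (0 < orient (p i) (p j) (p k))%R]| = n - 2)%N -> halving p i j.
Proof.
move=> cp ij; set P := [set k | _] => hP.
set Q := [set k | (orient (p i) (p j) (p k) < 0)%R].
have tot : (#|P| + #|Q| + #|[set i; j]| = n)%N.
  rewrite -cardsUI (_ : P :&: Q = set0) ?cards0 ?addn0; last first.
    apply/setP => k; rewrite !inE; case: ltgtP; by [].
  rewrite -cardsUI (_ : (P :|: Q) :&: _ = set0) ?cards0 ?addn0; last first.
    apply/setP => k; rewrite !inE andbC.
    case: eqP => [->|_]; first by rewrite orient_xyx ltxx.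
    by case: eqP => //= ->; rewrite orient_xyy ltxx.
  rewrite -[RHS]card_ord -cardsT; apply: eq_card => k; rewrite !inE.
  have [->|ki] := eqVneq k i; first by rewrite orbT.
  have [->|kj] := eqVneq k j; first by rewrite !orbT.
  by rewrite orbF -neq_lt [0 == _]eq_sym configuration_orient_neq0// eq_sym.
rewrite cards2 ij in tot.
by rewrite /halving -/P -/Q; apply/andP; split; apply/eqP; lia.
Qed.

Lemma sum_mod3 (F : nat -> nat) m :
  (\sum_(0 <= i < 3 * m) F i =
   \sum_(0 <= r < m) (F (3 * r) + F (3 * r + 1) + F (3 * r + 2)))%N.
Proof.
elim: m => [|m IH]; first by rewrite muln0 !big_geq.
rewrite mulnS addnC [in RHS]big_nat_recr//= -IH [in LHS]addn3.
by rewrite 3?big_nat_recr// /= addn1 addn2 !addnA.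
Qed.

Lemma sum_rotate3 (G : nat -> nat) s : (forall t, G t.+3 = G t) ->
  (G s + G s.+1 + G s.+2 = G 0 + G 1 + G 2)%N.
Proof. by move=> G3; elim: s => [|s <-] //; rewrite G3; lia. Qed.

Lemma sum_ltn N m : (m <= N)%N -> (\sum_(0 <= r < N) (r < m) = m)%N.
Proof.
move=> mN; rewrite (big_cat_nat (leq0n m) mN)/=.
rewrite (eq_big_nat _ _ (F2 := fun=> 1%N)); last by move=> r /andP[_ ->].
rewrite sum_nat_const_nat muln1 subn0 big1_seq ?addn0// => r.
by rewrite mem_index_iota => /andP[_ /andP[h _]]; rewrite ltnNge h.
Qed.

Lemma sum_geqn N m : (m <= N)%N -> (\sum_(0 <= r < N) (m <= r) = N - m)%N.
Proof.
move=> mN; apply/eqP; rewrite -(eqn_add2r m) subnK//; apply/eqP.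
rewrite -[X in (_ + X)%N](sum_ltn mN) -big_split/=.
rewrite -[RHS]muln1 -{2}[N]subn0 -sum_nat_const_nat.
by apply: eq_bigr => r _; case: leqP.
Qed.

(** Counting arm by arm, starting from any arm [s]: the points involved in a
    halving line are best located relatively to the arm on which it starts. *)
Lemma card_pinwheel (R : realType) n s (P : R * R -> bool) : (6 %| n)%N ->
  (#|[set i : 'I_n | P (pinwheel R i)]| =
   \sum_(0 <= r < 2 * (n %/ 6)) P (arm s (abscissa R (n %/ 6) r)) +
   \sum_(0 <= r < 2 * (n %/ 6)) P (arm s.+1 (abscissa R (n %/ 6) r)) +
   \sum_(0 <= r < 2 * (n %/ 6)) P (arm s.+2 (abscissa R (n %/ 6) r)))%N.
Proof.
move=> n6; set k := (n %/ 6)%N.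
pose G t := (\sum_(0 <= r < 2 * k) P (arm t (abscissa R k r)))%N.
have G3 t : G t.+3 = G t by apply: eq_bigr => r _; rewrite arm3.
rewrite -[RHS]/(G s + G s.+1 + G s.+2)%N sum_rotate3//.
transitivity (\sum_(i < n) P (pinwheel R i))%N.
  by rewrite -sum1dep_card [LHS]big_mkcond/=; apply: eq_bigr => i _; case: (P _).
rewrite /pinwheel.
rewrite -(big_mkord predT (fun i => P (arm i (abscissa R k (i %/ 3))) : nat)).
have -> : n = (3 * (2 * k))%N by rewrite /k; lia.
rewrite sum_mod3 /G -!big_split/=; apply: eq_bigr => r _.
have armE t : (t < 3)%N ->
    arm (3 * r + t) (abscissa R k ((3 * r + t) %/ 3)) = arm t (abscissa R k r).
  move=> t3; rewrite -arm_mod3 (_ : (3 * r + t) %/ 3 = r)%N; last by lia.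
  by rewrite (_ : (3 * r + t) %% 3 = t)%N//; lia.
by rewrite -[X in (P (arm X _) + _ + _)%N]addn0 -[X in (X %/ 3)%N]addn0 !armE.
Qed.

(** * Halving lines of the pinwheel *)

(** The default [i0] is the value for ranks out of range. *)
Definition vertex n (i0 : 'I_n) (s r : nat) : 'I_n := insubd i0 (3 * r + s %% 3)%N.

Lemma vertexE n (i0 : 'I_n) s r : (6 %| n)%N -> (r < 2 * (n %/ 6))%N ->
  vertex i0 s r = (3 * r + s %% 3)%N :> nat.
Proof.
move=> n6 rk; rewrite /vertex val_insubd (_ : _ < n)%N//.
by have := ltn_pmod s (isT : 0 < 3)%N; lia.
Qed.

Lemma vertex_inj n (i0 : 'I_n) s r s' r' : (6 %| n)%N ->
  (r < 2 * (n %/ 6))%N -> (r' < 2 * (n %/ 6))%N ->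
  vertex i0 s r = vertex i0 s' r' -> s = s' %[mod 3] /\ r = r'.
Proof.
move=> n6 rk rk' /(congr1 val); rewrite /= !vertexE// => E.
by have := ltn_pmod s (isT : 0 < 3)%N; have := ltn_pmod s' (isT : 0 < 3)%N; lia.
Qed.

Lemma pinwheel_vertex (R : realType) n (i0 : 'I_n) s r : (6 %| n)%N ->
  (r < 2 * (n %/ 6))%N ->
  pinwheel R (vertex i0 s r) = arm s (abscissa R (n %/ 6) r).
Proof.
move=> n6 rk; rewrite /pinwheel vertexE// -arm_mod3.
have s3 := ltn_pmod s (isT : 0 < 3)%N.
rewrite (_ : (3 * r + s %% 3) %/ 3 = r)%N; last by lia.
by rewrite (_ : (3 * r + s %% 3) %% 3 = s %% 3)%N ?arm_mod3//; lia.
Qed.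

(** On the left of the line from [r.+1] to [r] lie the [k - 1] inner points of
    the next arm and the [2k] points of the previous arm. *)
Lemma halving_along_arm (R : realType) n (i0 : 'I_n) s r : (6 %| n)%N ->
  (r.+1 < 2 * (n %/ 6))%N ->
  underlying_graph (@pinwheel R n) (vertex i0 s r.+1) (vertex i0 s r).
Proof.
move=> n6 rk; have n0 : (0 < n)%N by case: n i0 {n6 rk} => [[]|].
have ne : vertex i0 s r.+1 != vertex i0 s r.
  by apply/eqP => /(vertex_inj n6 rk (ltnW rk))[_]; lia.
rewrite /underlying_graph ne /=; apply: halving_one_side => //.
  exact: pinwheel_configuration.
rewrite !pinwheel_vertex//; last exact: ltnW.
rewrite (card_pinwheel s (fun q => 0 < orient _ _ q))//.
have xrr : abscissa R (n %/ 6) r < abscissa R (n %/ 6) r.+1 by rewrite abscissa_lt ?ltnSn.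
have IOr := abscissa_bound R (ltnW rk); have IOr1 := abscissa_bound R rk.
rewrite [X in (X + _ + _)%N]big_nat_cond big1 => [|l]; last first.
  rewrite andbT => /= lk; rewrite ltNge orient_same_arm_le0//.
  have [lr|rl] := leqP l r.
    by apply: mulr_le0; rewrite subr_le0; apply: abscissa_le;
      rewrite ?lr ?leqW ?(ltnW rk).
  by apply: mulr_ge0; rewrite subr_ge0; apply: abscissa_le; rewrite ?rl ?(ltnW rl).
rewrite (eq_big_nat _ _ (F2 := fun l => nat_of_bool (l < (n %/ 6).-1)%N)); last first.
  move=> l /andP[_ lk]; rewrite orient_swap oppr_gt0; congr nat_of_bool.
  case: ltnP => h; first by rewrite orient_next_inner// abscissa_inner.
  by rewrite ltNge ltW// orient_next_outer// abscissa_outer.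
rewrite sum_ltn; last by lia.
rewrite (eq_big_nat _ _ (F2 := fun=> 1%N)); last first.
  move=> l /andP[_ lk]; rewrite orient_swap oppr_gt0.
  by rewrite orient_prev// abscissa_bound.
by rewrite sum_nat_const_nat; lia.
Qed.

(** On the left lie the [2k - 2] points of the next arm that precede its last
    but one point, and the [k + 1] outer points of the previous arm.  For
    [k = 1] the innermost point is itself outer, but then there are no inner
    points and the same count holds. *)
Lemma halving_across_arms (R : realType) n (i0 : 'I_n) s : (6 %| n)%N ->
  underlying_graph (@pinwheel R n)
    (vertex i0 s 0) (vertex i0 s.+1 (2 * (n %/ 6) - 2)).
Proof.
move=> n6; have n0 : (0 < n)%N by case: n i0 {n6} => [[]|].
set k := (n %/ 6)%N; have k0 : (0 < k)%N by rewrite /k; lia.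
have m_lt : (2 * k - 2 < 2 * k)%N by lia.
have z_lt : (0 < 2 * k)%N by lia.
have ne : vertex i0 s 0 != vertex i0 s.+1 (2 * k - 2).
  by apply/eqP => /(vertex_inj n6 z_lt m_lt)[]; lia.
rewrite /underlying_graph ne /=; apply: halving_one_side => //.
  exact: pinwheel_configuration.
rewrite !pinwheel_vertex// -/k.
rewrite (card_pinwheel s (fun q => 0 < orient _ _ q))// -/k.
have Om : outer (abscissa R k (2 * k - 2)) by rewrite abscissa_outer//; lia.
have I0 := abscissa_bound R z_lt.
rewrite [X in (X + _ + _)%N]big_nat_cond big1 => [|l]; last first.
  rewrite andbT => /= lk; case: l lk => [|l] lk; first by rewrite orient_xyx ltxx.
  rewrite orient_swapr oppr_gt0 ltNge ltW// orient_next_outer//.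
    exact: abscissa_bound.
  by rewrite abscissa_lt.
rewrite (eq_big_nat _ _ (F2 := fun l => nat_of_bool (l < 2 * k - 2)%N)); last first.
  move=> l /andP[_ lk]; congr nat_of_bool; rewrite -orient_cycle.
  have Il := abscissa_bound R lk; rewrite -[arm s _]arm3.
  case: (ltngtP l (2 * k - 2)) => [lm|ml|->]; last by rewrite orient_xxy ltxx.
    by rewrite orient_swap oppr_gt0 orient_prev// ?Om ?orbT// abscissa_lt ?lm.
  by rewrite ltNge ltW// orient_prev// ?Om ?orbT// abscissa_lt ?ml.
rewrite sum_ltn; last by lia.
rewrite (eq_big_nat _ _ (F2 := fun l => nat_of_bool (k.-1 <= l)%N)); last first.
  move=> l /andP[_ lk]; congr nat_of_bool; case: leqP => h.
    by rewrite orient_arms_outer2// abscissa_outer.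
  rewrite ltNge ltW// orient_arms_inner_outer//; apply: abscissa_inner => //.
  exact: leq_ltn_trans h.
by rewrite sum_geqn; lia.
Qed.

(** * The long cycle *)

Lemma cycle_mkseq (T : Type) (e : rel T) (f : nat -> T) m :
  (forall j, e (f j) (f j.+1)) -> f m = f 0 -> cycle e (mkseq f m).
Proof.
case: m => // m ef fm; rewrite /mkseq /= rcons_path.
have pathf i q : path e (f i) [seq f j | j <- iota i.+1 q].
  by elim: q i => //= q IH i; rewrite ef IH.
rewrite pathf /= last_map.
have -> : last 0%N (iota 1 m) = m.
  by case: m {fm} => // m; rewrite -nth_last size_iota nth_iota.
by rewrite -fm.
Qed.

(** Arms in increasing order, ranks decreasing from [2k - 2] to 0 on each arm.
    Being periodic of period [3 (2k - 1)], it closes up by itself. *)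
Definition traversal n (i0 : 'I_n) (j : nat) : 'I_n :=
  let m := (2 * (n %/ 6) - 1)%N in vertex i0 (j %/ m) (m.-1 - j %% m).

Lemma traversal_edge (R : realType) n (i0 : 'I_n) j : (6 %| n)%N ->
  underlying_graph (@pinwheel R n) (traversal i0 j) (traversal i0 j.+1).
Proof.
move=> n6; have n0 : (0 < n)%N by case: n i0 {n6} => [[]|].
rewrite /traversal; set m := (2 * (n %/ 6) - 1)%N.
have m0 : (0 < m)%N by rewrite /m; lia.
have jm := ltn_pmod j m0.
have [h|h] := ltnP (j %% m).+1 m.
  have -> : (j.+1 %/ m = j %/ m)%N.
    by rewrite {1}(divn_eq j m) -addnS divnMDl// (divn_small h) addn0.
  have -> : (j.+1 %% m = (j %% m).+1)%N.
    by rewrite {1}(divn_eq j m) -addnS modnMDl (modn_small h).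
  have -> : (m.-1 - j %% m = (m.-1 - (j %% m).+1).+1)%N by lia.
  by apply: halving_along_arm => //; rewrite /m; lia.
(* At the end of an arm the traversal jumps to the next one. *)
have E : ((j %% m).+1 = m)%N by lia.
have Ej : (j.+1 = (j %/ m).+1 * m)%N by rewrite {1}(divn_eq j m) -addnS E mulSn addnC.
rewrite Ej mulnK// modnMl subn0 (_ : m.-1 - j %% m = 0)%N; last by lia.
rewrite (_ : m.-1 = 2 * (n %/ 6) - 2)%N; last by rewrite /m; lia.
exact: halving_across_arms.
Qed.

Lemma pinwheel_cycle_length (R : realType) n : (0 < n)%N -> (6 %| n)%N ->
  cycle_length R n (n - 3)%N.
Proof.
move=> n0 n6; exists (@pinwheel R n); split; first exact: pinwheel_configuration.
pose i0 := Ordinal n0; exists (mkseq (traversal i0) (n - 3)).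
have m0 : (0 < 2 * (n %/ 6) - 1)%N by lia.
have nm : (n - 3 = 3 * (2 * (n %/ 6) - 1))%N by lia.
rewrite size_mkseq; split=> //; split; first by rewrite size_mkseq; lia.
apply/andP; split.
  apply: cycle_mkseq => [j|]; first exact: traversal_edge.
  rewrite /traversal nm mulnK// div0n modnMl mod0n.
  by rewrite /vertex modnn mod0n.
apply/mkseq_uniqP => i j; rewrite !inE nm /traversal.
set m := (2 * (n %/ 6) - 1)%N in m0 * => im jm.
have il := ltn_pmod i m0; have jl := ltn_pmod j m0.
have rank_lt q : (m.-1 - q < 2 * (n %/ 6))%N by rewrite /m; lia.
case/(vertex_inj n6 (rank_lt _) (rank_lt _)).
rewrite [LHS]modn_small ?ltn_divLR// [RHS]modn_small ?ltn_divLR// => E1 E2.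
have E3 : (i %% m = j %% m)%N by lia.
by rewrite (divn_eq i m) (divn_eq j m) E1 E3.
Qed.

Theorem theorem5p7 (R : realType) (n : nat) (n_gt0 : (0 < n)%N)
    (n_mul6 : (6 %| n)%N) :
  is_maximum (cycle_length R n) (n - 3)%N.
Proof.
split; first exact: pinwheel_cycle_length.
by move=> m; apply: cycle_length_le; lia.
Qed.
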